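(* With $\rho$, $\mathrm{MC}_k$ and $C_k$ as defined in the context, put, for integers $0\le k\le 9$ and positive integers $n$, $$E_k(n):=\pi-\sum_{m=0}^{n-1}\frac{\rho(m)}{16^m}-\frac{1}{16^n}\mathrm{MC}_k(n).$$ Then for all integers $0\le k\le 9$, $$\lim_{n\to\infty}16^{n}\,n^{2k+5}E_k(n)=\frac{16\,C_k}{15}.$$
   Context: $\rho(m)=\frac{4}{8m+1}-\frac{2}{8m+4}-\frac{1}{8m+5}-\frac{1}{8m+6}$ (so that $\pi=\sum_{m\ge 0}\rho(m)/16^m$). Finite continued fraction notation: $K_{j=1}^{k}\frac{a_j}{n+b_j}$ means $\cfrac{a_1}{n+b_1+\cfrac{a_2}{n+b_2+\cdots+\cfrac{a_k}{n+b_k}}}$, and it is $0$ for $k=0$. For $0\le k\le 9$, $$\mathrm{MC}_k(n)=\frac{\frac14}{(n+\frac{7}{16})^2-\frac{73}{256}+K_{j=1}^{k}\frac{a_j}{n+b_j}},$$ where $a_1=\frac{21}{64}$, $b_1=\frac{15}{7}$; $a_2=-\frac{265}{392}$, $b_2=\frac{9299}{2968}$; $a_3=-\frac{3381}{2809}$, $b_3=\frac{20517}{4876}$; $a_4=-\frac{18921}{8464}$, $b_4=\frac{94519}{21896}$; $a_5=-\frac{3260043}{453152}$, $b_5=\frac{25408967}{7496524}$; $a_6=-\frac{3740382415}{496062002}$, $b_6=\frac{482484243355}{72002790104}$; $a_7=-\frac{435259601465}{326597391169}$, $b_7=\frac{133863589556959}{4859799720860}$; $a_8=\frac{18170745077870217}{36157137144200}$,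 $b_8=-\frac{550189873911066313}{30042487323672220}$; $a_9=\frac{1184188272901493239625}{399390489791710771232}$, $b_9=\frac{55409761792537711960915}{5291704918098810592904}$. Constants: $C_0=-\frac{315}{4096}$, $C_1=-\frac{11925}{229376}$, $C_2=-\frac{108675}{1736704}$, $C_3=-\frac{1686825}{12058624}$, $C_4=-\frac{287025525}{285212672}$, $C_5=-\frac{4009909971375}{528448749568}$, $C_6=-\frac{27702923551875}{2739417382912}$, $C_7=\frac{580053423565590975}{114135803101184}$, $C_8=-\frac{457280686810171702603125}{30346857643463671808}$, $C_9=-\frac{197080602286603349404715625}{1608316872287169019904}$. *)

(* Defs.v *)
(* Stdlib world (real numbers [R]), with Coquelicot for limits. *)
From Stdlib Require Import Reals.
From Coquelicot Require Import Coquelicot.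
Open Scope R_scope.

Definition rho (m : nat) : R :=
  4 / (8 * INR m + 1) - 2 / (8 * INR m + 4)
  - 1 / (8 * INR m + 5) - 1 / (8 * INR m + 6).

(* Only the indices 1, ..., 9 are meaningful for [a] and [b], and
   0, ..., 9 for [C_const]; the value 0 elsewhere is junk. *)
Definition a (j : nat) : R :=
  match j with
  | 1%nat => 21 / 64
  | 2%nat => - (265 / 392)
  | 3%nat => - (3381 / 2809)
  | 4%nat => - (18921 / 8464)
  | 5%nat => - (3260043 / 453152)
  | 6%nat => - (3740382415 / 496062002)
  | 7%nat => - (435259601465 / 326597391169)
  | 8%nat => 18170745077870217 / 36157137144200
  | 9%nat => 1184188272901493239625 / 399390489791710771232
  | _ => 0
  end.

Definition b (j : nat) : R :=
  match j with
  | 1%nat => 15 / 7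
  | 2%nat => 9299 / 2968
  | 3%nat => 20517 / 4876
  | 4%nat => 94519 / 21896
  | 5%nat => 25408967 / 7496524
  | 6%nat => 482484243355 / 72002790104
  | 7%nat => 133863589556959 / 4859799720860
  | 8%nat => - (550189873911066313 / 30042487323672220)
  | 9%nat => 55409761792537711960915 / 5291704918098810592904
  | _ => 0
  end.

Definition C_const (k : nat) : R :=
  match k with
  | 0%nat => - (315 / 4096)
  | 1%nat => - (11925 / 229376)
  | 2%nat => - (108675 / 1736704)
  | 3%nat => - (1686825 / 12058624)
  | 4%nat => - (287025525 / 285212672)
  | 5%nat => - (4009909971375 / 528448749568)
  | 6%nat => - (27702923551875 / 2739417382912)
  | 7%nat => 580053423565590975 / 114135803101184
  | 8%nat => - (457280686810171702603125 / 30346857643463671808)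
  | 9%nat => - (197080602286603349404715625 / 1608316872287169019904)
  | _ => 0
  end.

(* The [len] levels of the fraction with indices j, ..., j + len - 1:
   a_j / (x + b_j + a_(j+1) / (x + b_(j+1) + ...)). *)
Fixpoint cfrac_from (j len : nat) (x : R) : R :=
  match len with
  | O => 0
  | S len' => a j / (x + b j + cfrac_from (S j) len' x)
  end.

Definition MC (k n : nat) : R :=
  (1 / 4) / ((INR n + 7 / 16) ^ 2 - 73 / 256 + cfrac_from 1 k (INR n)).

(* [sum_f_R0 f N] has N + 1 terms, so for n >= 1 the sum below runs over
   m = 0, ..., n - 1; the value at n = 0 is junk. *)
Definition E (k n : nat) : R :=
  PI - sum_f_R0 (fun m => rho m / 16 ^ m) (n - 1) - 1 / 16 ^ n * MC k n.

(* Main.v *)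
(** Put D_k(n) = 16^n (E_k(n) - E_k(n+1)) = rho(n) - MC_k(n) + MC_k(n+1)/16.
    This is a rational function of n whose expansion at infinity starts with
    C_k / n^(2k+5).  Since E_k(n) -> 0 by the Bailey-Borwein-Plouffe series for
    pi, comparing E_k(n) with v(n) = 16^(-n) n^(-2k-5) by the Stolz-Cesaro
    theorem in its 0/0 form gives C_k / (1 - 1/16) = 16 C_k / 15.  The leading
    term of D_k is computed by normalizing D_k, as a function of t = 1/n, to a
    quotient of polynomials with rational coefficients. *)
Require Import Defs.
From Stdlib Require Import Reals Lra Lia QArith Qreals List.
From Coquelicot Require Import Coquelicot.
Import ListNotations.
Open Scope R_scope.

(** * The Bailey-Borwein-Plouffe series with an error bound *)

(** Since rho(m) is the integral over [0,1] of y^(8m) (4 - 2y^3 - y^4 - y^5), the partial sums come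
    from a truncated geometric series in y^8/16. The remainder gives the bound. *)
Lemma rho_partial_sum_bound (N : nat) :
  Rabs (PI - sum_f_R0 (fun m => rho m / 16 ^ m) N) <= 5 * (1 / 16) ^ S N.
Proof.
(* H is an antiderivative of the sum h of the derivatives of all the terms g m,
   H 1 - H 0 = PI, and h - G' = h (y ^ 8 / 16) ^ S N; conclude by the mean
   value theorem for H - G. *)
pose (H := fun y => 2 * ln (2 - y ^ 2) - 2 * ln (y ^ 2 - 2 * y + 2)
                    + 4 * atan (y - 1)).
pose (h := fun y => (4 - 2 * y ^ 3 - y ^ 4 - y ^ 5) / (1 - y ^ 8 / 16)).
pose (g := fun (m : nat) y =>
  (4 * y ^ (8 * m + 1) / (8 * INR m + 1) - 2 * y ^ (8 * m + 4) / (8 * INR m + 4)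
   - y ^ (8 * m + 5) / (8 * INR m + 5) - y ^ (8 * m + 6) / (8 * INR m + 6))
  / 16 ^ m).
pose (G := fun y => sum_f_R0 (fun m => g m y) N).
assert (pow8 : forall y, 0 <= y <= 1 -> 0 <= y ^ 8 <= 1).
{ intros y Hy; split; [now apply pow_le|].
  rewrite <- (pow1 8); apply pow_incr; lra. }
assert (dH : forall y, 0 <= y <= 1 -> is_derive H y (h y)).
{ intros y Hy; assert (Hy8 := pow8 y Hy); unfold H, h.
  auto_derive; [repeat split; nra|].
  (* The numerator of [h] is (1 - y)(y^2 + 2)(y^2 + 2y + 2), and the last two factors divide 16 -
     y^8. Hence h = 16(1 - y) / ((2 - y^2)(y^2 - 2y + 2)), whose partial fractions integrate to
     [H]. *)
  field; repeat split; nra. }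
assert (dg : forall m y, is_derive (g m) y
          ((y ^ 8 / 16) ^ m * (4 - 2 * y ^ 3 - y ^ 4 - y ^ 5))).
{ intros m y; unfold g; assert (Hm := pos_INR m).
  assert (H16 : 16 ^ m <> 0) by (apply pow_nonzero; lra).
  auto_derive; [repeat split; lra|].
  change (m + (m + (m + (m + (m + (m + (m + (m + 0))))))))%nat with (8 * m)%nat.
  replace (Init.Nat.pred (8 * m + 1)) with (8 * m)%nat by lia.
  replace (Init.Nat.pred (8 * m + 4)) with (8 * m + 3)%nat by lia.
  replace (Init.Nat.pred (8 * m + 5)) with (8 * m + 4)%nat by lia.
  replace (Init.Nat.pred (8 * m + 6)) with (8 * m + 5)%nat by lia.
  replace ((y ^ 8 / 16) ^ m) with (y ^ (8 * m) / 16 ^ m)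
    by (unfold Rdiv; rewrite Rpow_mult_distr, pow_inv, pow_mult; ring).
  rewrite !plus_INR, mult_INR, !pow_add.
  simpl INR; field; repeat split; lra. }
assert (dG : forall y, is_derive G y
          (sum_f_R0 (fun m => (y ^ 8 / 16) ^ m) N * (4 - 2 * y ^ 3 - y ^ 4 - y ^ 5))).
{ intros y; rewrite Rmult_comm, scal_sum; unfold G.
  induction N as [|M IH]; simpl sum_f_R0; [apply dg|].
  apply (is_derive_plus (fun y => sum_f_R0 (fun m => g m y) M)); [apply IH | apply dg]. }
destruct (MVT_cor2 (fun y => H y - G y)
   (fun y => h y * (y ^ 8 / 16) ^ S N) 0 1 Rlt_0_1) as [c [Hc Hc01]].
{ intros y Hy; apply is_derive_Reals.
  assert (Hy8 := pow8 y Hy).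
  evar_last; [apply (is_derive_minus H G); [now apply dH | apply dG]|].
  unfold minus, plus, opp; simpl.
  rewrite tech3 by lra; unfold h; simpl; field; lra. }
assert (HG1 : G 1 = sum_f_R0 (fun m => rho m / 16 ^ m) N).
{ apply sum_eq; intros m _; unfold g, rho; rewrite !pow1.
  assert (Hm := pos_INR m).
  field; repeat split; try lra; apply pow_nonzero; lra. }
assert (HG0 : G 0 = 0).
{ unfold G; rewrite (sum_eq _ (fun _ => 0)); [now rewrite sum_eq_R0|].
  intros m _; unfold g; rewrite !pow_i by lia; unfold Rdiv; ring. }
assert (HH : H 1 - H 0 = PI).
{ unfold H.
  replace (2 - 1 ^ 2) with 1 by ring.
  replace (1 ^ 2 - 2 * 1 + 2) with 1 by ring.
  replace (2 - 0 ^ 2) with 2 by ring.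
  replace (0 ^ 2 - 2 * 0 + 2) with 2 by ring.
  replace (1 - 1) with 0 by ring.
  replace (0 - 1) with (-1) by ring.
  replace (atan (-1)) with (- (PI / 4)) by (rewrite <- atan_1, <- atan_opp; f_equal; ring).
  rewrite ln_1, atan_0; field. }
replace (PI - _) with (h c * (c ^ 8 / 16) ^ S N) by lra.
assert (Hc8 := pow8 c ltac:(lra)).
rewrite Rabs_mult, <- RPow_abs, (Rabs_pos_eq (c ^ 8 / 16)) by lra.
apply Rmult_le_compat; [apply Rabs_pos | apply pow_le; lra | | apply pow_incr; lra].
assert (Hpow : forall n, 0 <= c ^ n <= 1).
{ intros n; split; [apply pow_le; lra|].
  rewrite <- (pow1 n); apply pow_incr; lra. }
assert (H3 := Hpow 3%nat); assert (H4 := Hpow 4%nat); assert (H5 := Hpow 5%nat).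
(* On [0,1] the numerator of [h] lies in [0,4] and its denominator is at least 15/16, so 0 <= h <=
   64/15 < 5. *)
unfold h; rewrite Rabs_pos_eq.
- apply (Rmult_le_reg_r (1 - c ^ 8 / 16)); [lra|].
  unfold Rdiv at 1; rewrite Rmult_assoc, Rinv_l by lra; lra.
- apply Rmult_le_pos; [lra | left; apply Rinv_0_lt_compat; lra].
Qed.

(** * Stolz-Cesaro theorem, 0/0 form *)

Lemma stolz_cesaro_0 (u v : nat -> R) (l : R) :
  is_lim_seq u 0 -> is_lim_seq v 0 -> eventually (fun n => v (S n) < v n) ->
  is_lim_seq (fun n => (u n - u (S n)) / (v n - v (S n))) l ->
  is_lim_seq (fun n => u n / v n) l.
Proof.
intros Hu Hv Hdecr Hl.
(* An eventually nondecreasing sequence stays below its limit; this replaces the summation of the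
   tails of [u] and [v]. *)
assert (incr0 : forall (w : nat -> R) N, is_lim_seq w 0 ->
   (forall n, (N <= n)%nat -> w n <= w (S n)) -> forall n, (N <= n)%nat -> w n <= 0).
{ intros w N Hw Hincr n Hn.
  apply (is_lim_seq_incr_compare (fun i => w (i + n)%nat) 0) with (n := 0%nat).
  - now apply -> is_lim_seq_incr_n.
  - intros i; apply Hincr; lia. }
apply is_lim_seq_spec in Hl; apply is_lim_seq_spec; intros eps.
destruct (Hl (pos_div_2 eps)) as [N1 HN1]; destruct Hdecr as [N2 HN2]; simpl in HN1.
assert (Heps := cond_pos eps).
exists (N1 + N2)%nat; intros n Hn.
assert (Hstep : forall m, (N1 + N2 <= m)%nat ->
   Rabs (u m - u (S m) - l * (v m - v (S m))) <= eps / 2 * (v m - v (S m))).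
{ intros m Hm; assert (Hd := HN2 m ltac:(lia)); assert (H := HN1 m ltac:(lia)).
  replace (_ - _ - _) with
    (((u m - u (S m)) / (v m - v (S m)) - l) * (v m - v (S m))) by (field; lra).
  rewrite Rabs_mult, (Rabs_pos_eq (v m - v (S m))) by lra.
  apply Rmult_le_compat_r; lra. }
(* Positivity follows from the strict decrease to 0: v n > v (S n) >= 0. *)
assert (Hvpos : 0 < v n).
{ assert (Hd := HN2 n ltac:(lia)).
  assert (- v (S n) <= 0); [|lra].
  apply (incr0 (fun m => - v m) N2); [|intros m Hm; assert (H := HN2 m Hm); lra|lia].
  rewrite <- Ropp_0; now apply (is_lim_seq_opp v 0). }
assert (Hcomb : forall c d, is_lim_seq (fun m => c * u m + d * v m) 0).
{ intros c d.
  replace 0 with (c * 0 + d * 0) by ring.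
  apply is_lim_seq_plus'; now apply (is_lim_seq_scal_l _ _ 0). }
(* u - (l + eps/2) v and - u + (l - eps/2) v are eventually nondecreasing with
   limit 0, hence nonpositive. *)
assert (Hup : 1 * u n + (- l - eps / 2) * v n <= 0).
{ apply (incr0 (fun m => 1 * u m + (- l - eps / 2) * v m) (N1 + N2)%nat);
    [apply Hcomb | | lia].
  intros m Hm; assert (H := proj1 (Rabs_le_between _ _) (Hstep m Hm)); lra. }
assert (Hdn : -1 * u n + (l - eps / 2) * v n <= 0).
{ apply (incr0 (fun m => -1 * u m + (l - eps / 2) * v m) (N1 + N2)%nat);
    [apply Hcomb | | lia].
  intros m Hm; assert (H := proj1 (Rabs_le_between _ _) (Hstep m Hm)); lra. }
replace (u n / v n - l) with ((u n - l * v n) / v n) by (field; lra).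
rewrite Rabs_div, (Rabs_pos_eq (v n)) by lra.
apply Rlt_div_l; [lra|].
apply Rle_lt_trans with (eps / 2 * v n); [apply Rabs_le; lra | nra].
Qed.


(** * Computable polynomials over the rationals *)

(* Coefficients are listed from the constant term upwards. *)
Fixpoint peval (p : list Q) (t : R) : R :=
  match p with
  | [] => 0
  | c :: p' => Q2R c + t * peval p' t
  end.

(** [Qred] here and in [pmul] keeps the fractions in lowest terms, which limits their growth during
    [vm_compute]. *)
Fixpoint padd (p q : list Q) : list Q :=
  match p, q with
  | [], _ => q
  | _, [] => p
  | c :: p', d :: q' => Qred (c + d) :: padd p' q'
  end.

Fixpoint pmul (p q : list Q) : list Q :=
  match p with
  | [] => []
  | c :: p' => padd (map (fun d => Qred (c * d)) q) (0%Q :: pmul p' q)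
  end.

Lemma Q2R_Qred (q : Q) : Q2R (Qred q) = Q2R q.
Proof. apply Qeq_eqR, Qred_correct. Qed.

Lemma peval_padd (p q : list Q) (t : R) : peval (padd p q) t = peval p t + peval q t.
Proof.
revert q; induction p as [|c p IH]; intros [|d q]; cbn [padd peval]; try ring.
rewrite Q2R_Qred, Q2R_plus, IH; ring.
Qed.

Lemma peval_pmul (p q : list Q) (t : R) : peval (pmul p q) t = peval p t * peval q t.
Proof.
induction p as [|c p IH]; cbn [pmul peval]; [ring|].
rewrite peval_padd; cbn [peval]; rewrite IH, RMicromega.Q2R_0.
assert (Hs : peval (map (fun d => Qred (c * d)) q) t = Q2R c * peval q t).
{ clear IH; induction q as [|d q IHq]; cbn [map peval]; [ring|].
  rewrite Q2R_Qred, Q2R_mult, IHq; ring. }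
rewrite Hs; ring.
Qed.

Lemma peval_0 (p : list Q) : peval p 0 = Q2R (hd 0%Q p).
Proof. destruct p; simpl; [now rewrite RMicromega.Q2R_0 | ring]. Qed.

Lemma continuous_peval (p : list Q) (t : R) : continuous (peval p) t.
Proof.
induction p as [|c p IH]; [apply continuous_const|].
apply (continuous_plus (fun _ => Q2R c) (fun t => t * peval p t));
  [apply continuous_const | apply (continuous_mult (K := R_AbsRing) (fun t => t) (peval p)); [apply continuous_id | exact IH]].
Qed.

Lemma peval_low_zeros (r : nat) (p : list Q) (t : R) :
  forallb (fun c => Qeq_bool c 0) (firstn r p) = true ->
  peval p t = t ^ r * peval (skipn r p) t.
Proof.
revert p; induction r as [|r IH]; intros [|c p]; simpl; intros H; try ring.
apply andb_prop in H; destruct H as [Hc Hp].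
apply Qeq_bool_eq, Qeq_eqR in Hc.
rewrite Hc, RMicromega.Q2R_0, (IH p Hp); ring.
Qed.

(** * Normal forms and leading coefficients of rational functions *)

Inductive expr : Type :=
| Cst (q : Q)
| Var
| Add (e f : expr)
| Mul (e f : expr)
| Inv (e : expr).

Fixpoint interp (e : expr) (t : R) : R :=
  match e with
  | Cst q => Q2R q
  | Var => t
  | Add e f => interp e t + interp f t
  | Mul e f => interp e t * interp f t
  | Inv e => / interp e t
  end.

(* Fails on the inverse of an expression vanishing at 0, so that every
   denominator returned is nonzero at 0. *)
Fixpoint norm (e : expr) : option (list Q * list Q) :=
  match e with
  | Cst q => Some ([q], [1%Q])
  | Var => Some ([0%Q; 1%Q], [1%Q])
  | Add e f =>
      match norm e, norm f with
      | Some (n1, d1), Some (n2, d2) =>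
          Some (padd (pmul n1 d2) (pmul n2 d1), pmul d1 d2)
      | _, _ => None
      end
  | Mul e f =>
      match norm e, norm f with
      | Some (n1, d1), Some (n2, d2) => Some (pmul n1 n2, pmul d1 d2)
      | _, _ => None
      end
  | Inv e =>
      match norm e with
      | Some (n, d) => if Qeq_bool (hd 0%Q n) 0 then None else Some (d, n)
      | None => None
      end
  end.

Lemma peval_neq_0_locally (p : list Q) :
  peval p 0 <> 0 -> locally 0 (fun t => peval p t <> 0).
Proof.
intros Hp; apply (continuous_peval p 0 (fun y => y <> 0)).
now apply open_neq.
Qed.

(** Equality is claimed only near 0, where continuity keeps the denominators nonzero; addition uses
    this to form a common denominator. The test made by [norm] on [Inv] preserves d(0) <> 0. *)
Lemma norm_correct (e : expr) (n d : list Q) :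
  norm e = Some (n, d) ->
  peval d 0 <> 0 /\ locally 0 (fun t => interp e t = peval n t / peval d t).
Proof.
revert n d.
induction e as [q| |e IHe f IHf|e IHe f IHf|e IHe]; simpl; intros n d H.
- injection H as <- <-; simpl; rewrite RMicromega.Q2R_1; split; [lra|].
  apply filter_forall; intros t; rewrite !Rmult_0_r, !Rplus_0_r, Rdiv_1_r; reflexivity.
- injection H as <- <-; simpl; rewrite RMicromega.Q2R_1, RMicromega.Q2R_0.
  split; [lra|].
  apply filter_forall; intros t.
  rewrite !Rmult_0_r, !Rplus_0_r, Rdiv_1_r, Rplus_0_l, Rmult_1_r; reflexivity.
- destruct (norm e) as [[n1 d1]|]; [|discriminate].
  destruct (norm f) as [[n2 d2]|]; [|discriminate].
  injection H as <- <-.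
  destruct (IHe _ _ eq_refl) as [He0 He], (IHf _ _ eq_refl) as [Hf0 Hf].
  split; [rewrite peval_pmul; now apply Rmult_integral_contrapositive|].
  generalize (filter_and _ _ (filter_and _ _ He (peval_neq_0_locally _ He0))
                             (filter_and _ _ Hf (peval_neq_0_locally _ Hf0))).
  apply filter_imp; intros t [[-> Hd1] [-> Hd2]].
  rewrite peval_padd, !peval_pmul; field; now split.
- destruct (norm e) as [[n1 d1]|]; [|discriminate].
  destruct (norm f) as [[n2 d2]|]; [|discriminate].
  injection H as <- <-.
  destruct (IHe _ _ eq_refl) as [He0 He], (IHf _ _ eq_refl) as [Hf0 Hf].
  split; [rewrite peval_pmul; now apply Rmult_integral_contrapositive|].
  generalize (filter_and _ _ He Hf); apply filter_imp; intros t [-> ->].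
  rewrite !peval_pmul; unfold Rdiv; rewrite Rinv_mult; ring.
- destruct (norm e) as [[n1 d1]|]; [|discriminate].
  destruct (Qeq_bool (hd 0%Q n1) 0) eqn:Hn; [discriminate|].
  injection H as <- <-.
  destruct (IHe _ _ eq_refl) as [_ He].
  split.
  + rewrite peval_0; intros Hz; apply Qeq_bool_neq in Hn; apply Hn, eqR_Qeq.
    now rewrite Hz, RMicromega.Q2R_0.
  + revert He; apply filter_imp; intros t ->.
    unfold Rdiv; rewrite Rinv_mult, Rinv_inv; ring.
Qed.

(* The coefficient of t ^ r in the expansion of [e] at 0, provided that all the
   lower ones vanish. *)
Definition order_coef (r : nat) (e : expr) : option Q :=
  match norm e with
  | Some (n, d) =>
      if forallb (fun c => Qeq_bool c 0) (firstn r n)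
      then Some (hd 0%Q (skipn r n) / hd 0%Q d)%Q else None
  | None => None
  end.

(** At t = 1/n the factor t^r of the numerator cancels n^r, and what remains is a quotient of
    polynomials continuous at 0. *)
Lemma is_lim_seq_order_coef (r : nat) (e : expr) (c : Q) :
  order_coef r e = Some c ->
  is_lim_seq (fun n => INR n ^ r * interp e (/ INR n)) (Q2R c).
Proof.
unfold order_coef; destruct (norm e) as [[p d]|] eqn:He; [|discriminate].
destruct (forallb _ _) eqn:Hz; [|discriminate]; intros H.
assert (Hc : c = (hd 0%Q (skipn r p) / hd 0%Q d)%Q) by congruence.
destruct (norm_correct _ _ _ He) as [Hd0 Hloc].
assert (Hinv : is_lim_seq (fun n => / INR n) 0).
{ apply (is_lim_seq_inv _ p_infty); [apply is_lim_seq_INR | discriminate]. }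
assert (Hq : forall q, is_lim_seq (fun n => peval q (/ INR n)) (peval q 0)).
{ intros q; apply is_lim_seq_continuous; [|exact Hinv].
  apply continuity_pt_filterlim, continuous_peval. }
rewrite Hc, Q2R_div by
  (intros Hh; apply Hd0; rewrite peval_0, (Qeq_eqR _ _ Hh); apply RMicromega.Q2R_0).
rewrite <- !peval_0.
apply (is_lim_seq_ext_loc
  (fun n => peval (skipn r p) (/ INR n) / peval d (/ INR n))).
- destruct (Hinv _ Hloc) as [N HN]; exists (S N); intros n Hn.
  rewrite (HN n) by lia; rewrite (peval_low_zeros r p) by exact Hz.
  assert (Hnz : INR n <> 0) by (apply not_0_INR; lia).
  assert (Hpz := pow_nonzero _ r Hnz).
  now unfold Rdiv; rewrite pow_inv, <- !Rmult_assoc, Rinv_r, Rmult_1_l.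
- now apply is_lim_seq_div'.
Qed.

(** * The increments D_k as expressions in 1/n *)

(** Rational copies of the real constants, on which [norm] can compute. *)
Definition aQ (j : nat) : Q :=
  match j with
  | 1%nat => 21 # 64
  | 2%nat => (-265) # 392
  | 3%nat => (-3381) # 2809
  | 4%nat => (-18921) # 8464
  | 5%nat => (-3260043) # 453152
  | 6%nat => (-3740382415) # 496062002
  | 7%nat => (-435259601465) # 326597391169
  | 8%nat => 18170745077870217 # 36157137144200
  | 9%nat => 1184188272901493239625 # 399390489791710771232
  | _ => 0
  end.

Definition bQ (j : nat) : Q :=
  match j with
  | 1%nat => 15 # 7
  | 2%nat => 9299 # 2968
  | 3%nat => 20517 # 4876
  | 4%nat => 94519 # 21896
  | 5%nat => 25408967 # 7496524
  | 6%nat => 482484243355 # 72002790104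
  | 7%nat => 133863589556959 # 4859799720860
  | 8%nat => (-550189873911066313) # 30042487323672220
  | 9%nat => 55409761792537711960915 # 5291704918098810592904
  | _ => 0
  end.

Definition CQ (k : nat) : Q :=
  match k with
  | 0%nat => (-315) # 4096
  | 1%nat => (-11925) # 229376
  | 2%nat => (-108675) # 1736704
  | 3%nat => (-1686825) # 12058624
  | 4%nat => (-287025525) # 285212672
  | 5%nat => (-4009909971375) # 528448749568
  | 6%nat => (-27702923551875) # 2739417382912
  | 7%nat => 580053423565590975 # 114135803101184
  | 8%nat => (-457280686810171702603125) # 30346857643463671808
  | 9%nat => (-197080602286603349404715625) # 1608316872287169019904
  | _ => 0
  end.

Lemma Q2R_aQ (j : nat) : Q2R (aQ j) = a j.
Proof. do 10 (destruct j as [|j]; [unfold Q2R; simpl; lra|]); unfold Q2R; simpl; lra. Qed.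

Lemma Q2R_bQ (j : nat) : Q2R (bQ j) = b j.
Proof. do 10 (destruct j as [|j]; [unfold Q2R; simpl; lra|]); unfold Q2R; simpl; lra. Qed.

Lemma Q2R_CQ (k : nat) : Q2R (CQ k) = C_const k.
Proof. do 10 (destruct k as [|k]; [unfold Q2R; simpl; lra|]); unfold Q2R; simpl; lra. Qed.

(* In the expressions below [Var] stands for 1/n and [s] for a shift of n, so
   that [n + s + b = (1 + (s + b) Var) / Var]. *)
Fixpoint cfrac_expr (s : Q) (j len : nat) : expr :=
  match len with
  | O => Cst 0
  | S len' =>
      Mul (Mul (Cst (aQ j)) Var)
        (Inv (Add (Add (Cst 1) (Mul (Cst (s + bQ j)) Var))
                  (Mul Var (cfrac_expr s (S j) len'))))
  end.

(** Numerator and denominator are multiplied by [Var]^2, so that the denominator is 1 at [Var] = 0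
    and [norm] accepts its inverse. *)
Definition MC_expr (s : Q) (k : nat) : expr :=
  Mul (Mul (Cst (1 # 4)) (Mul Var Var))
    (Inv (Add (Add (Add (Cst 1) (Mul (Cst (2 * (s + (7 # 16)))) Var))
                   (Mul (Cst ((s + (7 # 16)) * (s + (7 # 16)) - (73 # 256))) (Mul Var Var)))
              (Mul (Mul Var Var) (cfrac_expr s 1 k)))).

Definition rho_term_expr (c d : Q) : expr :=
  Mul (Mul (Cst c) Var) (Inv (Add (Cst 8) (Mul (Cst d) Var))).

Definition rho_expr : expr :=
  Add (Add (Add (rho_term_expr 4 1) (rho_term_expr (-2) 4))
           (rho_term_expr (-1) 5)) (rho_term_expr (-1) 6).

(** This is D_k; the shift 1 produces the term MC_k(n+1). *)
Definition step_expr (k : nat) : expr :=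
  Add (Add rho_expr (Mul (Cst (-1)) (MC_expr 0 k))) (Mul (Cst (1 # 16)) (MC_expr 1 k)).

Lemma cfrac_expr_correct (s : Q) (j len : nat) (t : R) :
  t <> 0 -> interp (cfrac_expr s j len) t = cfrac_from j len (/ t + Q2R s).
Proof.
intros Ht; revert j; induction len as [|len IH]; intros j;
  cbn [cfrac_expr interp cfrac_from]; [apply RMicromega.Q2R_0|].
rewrite IH, Q2R_aQ, Q2R_plus, Q2R_bQ, RMicromega.Q2R_1.
replace (1 + (Q2R s + b j) * t + t * cfrac_from (S j) len (/ t + Q2R s))
  with (t * (/ t + Q2R s + b j + cfrac_from (S j) len (/ t + Q2R s)))
  by (field; exact Ht).
unfold Rdiv; rewrite Rinv_mult, Rmult_assoc, <- (Rmult_assoc t), Rinv_r by exact Ht.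
ring.
Qed.

Lemma MC_expr_correct (i k n : nat) :
  (0 < n)%nat ->
  interp (MC_expr (inject_Z (Z.of_nat i)) k) (/ INR n) = MC k (n + i).
Proof.
intros Hn; assert (Hnz : INR n <> 0) by (apply not_0_INR; lia).
assert (Hs : Q2R (inject_Z (Z.of_nat i)) = INR i).
{ unfold Q2R; simpl; rewrite Rinv_1, Rmult_1_r; symmetry; apply INR_IZR_INZ. }
unfold MC_expr, MC; cbn [interp].
rewrite cfrac_expr_correct by (now apply Rinv_neq_0_compat).
rewrite Q2R_minus, !Q2R_mult, !Q2R_plus, Hs, Rinv_inv, <- plus_INR.
set (K := cfrac_from 1 k (INR (n + i))); rewrite plus_INR.
replace (Q2R (7 # 16)) with (7 / 16) by (unfold Q2R; simpl; lra).
replace (Q2R (73 # 256)) with (73 / 256) by (unfold Q2R; simpl; lra).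
replace (Q2R (1 # 4)) with (1 / 4) by (unfold Q2R; simpl; lra).
replace (Q2R 2) with 2 by (unfold Q2R; simpl; lra).
rewrite RMicromega.Q2R_1.
replace (1 + _ + _ + _)
  with ((/ INR n * / INR n) * ((INR n + INR i + 7 / 16) ^ 2 - 73 / 256 + K))
  by (field; exact Hnz).
unfold Rdiv at 1 4; rewrite (Rinv_mult (/ _ * / _)), Rinv_mult, Rinv_inv.
(* With the reciprocal abstracted, [field] only has to know that n is nonzero. *)
generalize (/ ((INR n + INR i + 7 / 16) ^ 2 - 73 / 256 + K)); intros Y.
now field.
Qed.

Lemma rho_expr_correct (n : nat) : (0 < n)%nat -> interp rho_expr (/ INR n) = rho n.
Proof.
intros Hn; assert (Hpos : 0 < INR n) by (apply lt_0_INR; lia).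
assert (Hinv := Rinv_0_lt_compat _ Hpos).
unfold rho_expr, rho_term_expr, rho; cbn [interp]; unfold Q2R; simpl; field.
repeat split; lra.
Qed.

Lemma E_step (k n : nat) :
  (0 < n)%nat -> 16 ^ n * (E k n - E k (S n)) = interp (step_expr k) (/ INR n).
Proof.
intros Hn; unfold step_expr; cbn [interp].
rewrite rho_expr_correct, (MC_expr_correct 0), (MC_expr_correct 1) by exact Hn.
rewrite Nat.add_0_r, Nat.add_1_r.
replace (Q2R (-1)) with (-1) by (unfold Q2R; simpl; lra).
replace (Q2R (1 # 16)) with (1 / 16) by (unfold Q2R; simpl; lra).
(* As n > 0, the truncated subtraction is exact, and the sum in [E k (S n)] has just the extra term
   rho(n)/16^n. *)
unfold E; replace (S n - 1)%nat with (S (n - 1)) by lia.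
rewrite tech5; replace (S (n - 1)) with n by lia.
assert (H16 : 16 ^ n <> 0) by (apply pow_nonzero; lra).
simpl pow; field; exact H16.
Qed.

(** * Verification of the ten expansions by computation *)

(** Success of [order_coef] certifies that the coefficients of t^0, ..., t^(2k+4) in the numerator
    vanish; the next one, divided by d(0), is compared with C_k. *)
Lemma step_expr_order (k : nat) :
  (k <= 9)%nat ->
  exists c, order_coef (2 * k + 5) (step_expr k) = Some c /\ Q2R c = C_const k.
Proof.
intros hk.
assert (Hall : forallb (fun k =>
    match order_coef (2 * k + 5) (step_expr k) with
    | Some c => Qeq_bool c (CQ k)
    | None => false
    end) (seq 0 10) = true) by (vm_compute; reflexivity).
rewrite forallb_forall in Hall.
specialize (Hall k ltac:(apply in_seq; lia)).
destruct (order_coef _ _) as [c|]; [|discriminate].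
exists c; split; [reflexivity|].
rewrite <- Q2R_CQ; now apply Qeq_eqR, Qeq_bool_eq.
Qed.

(** At order 0 nothing has to vanish, so this only says that [norm] succeeds. It yields a finite
    limit of MC_k(n), enough for MC_k(n)/16^n to tend to 0. *)
Lemma MC_expr_order (k : nat) :
  (k <= 9)%nat -> exists c, order_coef 0 (MC_expr 0 k) = Some c.
Proof.
intros hk.
assert (Hall : forallb (fun k =>
    match order_coef 0 (MC_expr 0 k) with Some _ => true | None => false end)
    (seq 0 10) = true) by (vm_compute; reflexivity).
rewrite forallb_forall in Hall.
specialize (Hall k ltac:(apply in_seq; lia)).
destruct (order_coef _ _) as [c|]; [now exists c | discriminate].
Qed.

(** * Convergence of E_k to 0 and the asymptotics *)

Lemma is_lim_seq_inv_pow16 : is_lim_seq (fun n => (1 / 16) ^ n) 0.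
Proof. apply is_lim_seq_geom; rewrite Rabs_pos_eq; lra. Qed.

Lemma E_lim (k : nat) : (k <= 9)%nat -> is_lim_seq (E k) 0.
Proof.
intros hk.
assert (Hsum : is_lim_seq (fun n => PI - sum_f_R0 (fun m => rho m / 16 ^ m) (n - 1)) 0).
{ apply is_lim_seq_abs_0.
  apply (is_lim_seq_le_le_loc (fun _ => 0) _ (fun n => 5 * (1 / 16) ^ n)).
  - exists 1%nat; intros n Hn; split; [apply Rabs_pos|].
    assert (H := rho_partial_sum_bound (n - 1)).
    now replace (S (n - 1)) with n in H by lia.
  - apply is_lim_seq_const.
  - replace 0 with (5 * 0) by ring; apply (is_lim_seq_scal_l _ 5 0).
    apply is_lim_seq_inv_pow16. }
destruct (MC_expr_order k hk) as [c Hc].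
assert (HMC : is_lim_seq (MC k) (Q2R c)).
{ apply is_lim_seq_ext_loc with (2 := is_lim_seq_order_coef _ _ _ Hc).
  exists 1%nat; intros n Hn.
  assert (H := MC_expr_correct 0 k n ltac:(lia)); rewrite Nat.add_0_r in H.
  rewrite <- H; simpl pow; apply Rmult_1_l. }
replace 0 with (0 - 0 * Q2R c) by ring.
apply is_lim_seq_minus'; [exact Hsum|].
apply is_lim_seq_mult'; [|exact HMC].
apply is_lim_seq_ext with (2 := is_lim_seq_inv_pow16); intros n.
unfold Rdiv; rewrite !Rmult_1_l; apply pow_inv.
Qed.

Theorem theorem1 (k : nat) (hk : (k <= 9)%nat) :
  is_lim_seq (fun n : nat => 16 ^ n * INR n ^ (2 * k + 5) * E k n)
    (Finite (16 * C_const k / 15)).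
Proof.
destruct (step_expr_order k hk) as [c [Hc HcC]].
set (p := (2 * k + 5)%nat) in *.
pose (v := fun n : nat => (1 / 16) ^ n * / INR n ^ p).
assert (Hratio : is_lim_seq (fun n => INR n / INR (S n)) 1).
{ replace 1 with (1 / (1 + 0)) by field.
  apply (is_lim_seq_ext_loc (fun n => 1 / (1 + / INR n))).
  - exists 1%nat; intros n Hn; rewrite S_INR.
    assert (0 < INR n) by (apply lt_0_INR; lia).
    field; lra.
  - apply is_lim_seq_div'; [apply is_lim_seq_const | | lra].
    apply is_lim_seq_plus'; [apply is_lim_seq_const|].
    apply (is_lim_seq_inv _ p_infty); [apply is_lim_seq_INR | discriminate]. }
assert (Hratiop : forall q, is_lim_seq (fun n => (INR n / INR (S n)) ^ q) 1).
{ induction q as [|q IH]; [apply is_lim_seq_const|].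
  replace 1 with (1 * 1) by ring; now apply is_lim_seq_mult'. }
(* Here 16 ^ n * n ^ p * (v n - v (S n)) = 1 - (n / (n + 1)) ^ p / 16. *)
assert (Hv : forall n, (0 < n)%nat ->
  v n - v (S n) = / (16 ^ n * INR n ^ p) * (1 - (INR n / INR (S n)) ^ p / 16)).
{ intros n Hn; unfold v, Rdiv; rewrite Rmult_1_l, Rpow_mult_distr, !pow_inv.
  assert (16 ^ n <> 0) by (apply pow_nonzero; lra).
  assert (INR n ^ p <> 0) by (apply pow_nonzero, not_0_INR; lia).
  assert (INR (S n) ^ p <> 0) by (apply pow_nonzero, not_0_INR; lia).
  rewrite <- tech_pow_Rmult; field; easy. }
assert (Hpos : forall n, (0 < n)%nat -> 0 < 16 ^ n * INR n ^ p).
{ intros n Hn; apply Rmult_lt_0_compat; apply pow_lt; [lra | apply lt_0_INR; lia]. }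
(* This makes the last factor in [Hv] at least 15/16, so [v] decreases strictly. *)
assert (Hlt : forall n, (0 < n)%nat -> (INR n / INR (S n)) ^ p <= 1).
{ intros n Hn; assert (0 < INR n) by (apply lt_0_INR; lia).
  rewrite <- (pow1 p); apply pow_incr; rewrite S_INR; split.
  - apply Rlt_le, Rdiv_lt_0_compat; lra.
  - apply Rle_div_l; lra. }
apply (is_lim_seq_ext_loc (fun n => E k n / v n)).
{ exists 1%nat; intros n Hn; unfold v, Rdiv.
  rewrite Rmult_1_l, pow_inv, !Rinv_mult, !Rinv_inv; ring. }
apply stolz_cesaro_0.
- now apply E_lim.
- apply (is_lim_seq_le_le_loc (fun _ => 0) _ (fun n => (1 / 16) ^ n)).
  + exists 1%nat; intros n Hn; unfold v.
    assert (H16 : 0 < (1 / 16) ^ n) by (apply pow_lt; lra).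
    assert (H1 : 1 <= INR n ^ p).
    { apply pow_R1_Rle; change 1 with (INR 1); apply le_INR; lia. }
    assert (Hi : / INR n ^ p <= 1) by (rewrite <- Rinv_1; apply Rinv_le_contravar; lra).
    assert (0 < / INR n ^ p) by (apply Rinv_0_lt_compat; lra).
    nra.
  + apply is_lim_seq_const.
  + apply is_lim_seq_inv_pow16.
- exists 1%nat; intros n Hn.
  assert (H := Hv n Hn); assert (Hl := Hlt n Hn).
  assert (Hi := Rinv_0_lt_compat _ (Hpos n Hn)); nra.
(* Both differences are multiplied by 16^n n^p: the numerator becomes n^p D_k(n), which tends to
   C_k, and the denominator tends to 15/16. *)
- apply (is_lim_seq_ext_loc (fun n =>
    (INR n ^ p * interp (step_expr k) (/ INR n)) / (1 - (INR n / INR (S n)) ^ p / 16))).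
  + exists 1%nat; intros n Hn.
    rewrite Hv, <- E_step by exact Hn.
    unfold Rdiv; rewrite (Rinv_mult (/ _)), Rinv_inv; ring.
  + replace (16 * C_const k / 15) with (C_const k / (1 - 1 / 16)) by field.
    apply is_lim_seq_div'; [rewrite <- HcC; now apply is_lim_seq_order_coef | | lra].
    apply is_lim_seq_minus'; [apply is_lim_seq_const|].
    apply is_lim_seq_div'; [apply Hratiop | apply is_lim_seq_const | lra].
Qed.
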